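(* Let $s \geq 2$ and $e_1, \ldots, e_s \geq 2$ be integers. Let $\mathscr{P}$ be a set of size $v = \prod_{i=1}^s e_i$ with a chain of partitions $\mathscr{C}_0 \prec \mathscr{C}_1 \prec \cdots \prec \mathscr{C}_s$ of $\mathscr{P}$, where $\mathscr{C}_0$ is the partition into singletons, $\mathscr{C}_s=\{\mathscr{P}\}$, and for $1\le i\le s$ each class of $\mathscr{C}_i$ contains exactly $e_i$ classes of $\mathscr{C}_{i-1}$. Let $G = S_{e_1} \wr \ldots \wr S_{e_s}$ be the iterated wreath product acting on $\mathscr{P}$ as the full stabiliser in $\mathrm{Sym}(\mathscr{P})$ of this chain. Let $\mathscr{D} = (\mathscr{P},\mathscr{B})$ where $\mathscr{B} = B^G=\{B^g\mid g\in G\}$ for some $k$-subset $B$ of $\mathscr{P}$. For a class $C$ of any $\mathscr{C}_i$ put $x_C := |B\cap C|$, and for $C\in\mathscr{C}_{i-1}$ let $C^+$ denote the unique $\mathscr{C}_i$-class containing $C$. Then $\mathscr{D}$ is a $G$-block-transitive, $(G,s)$-chain-imprimitive $2$-design if and only if the following equations hold: $$\text{(A)}\quad \sum_{C \in \mathscr{C}_1} x_{C} \left( x_{C} - 1 \right) = \frac{k(k-1)}{v-1} (e_1 - 1)$$ and $$\text{(B)}\quad \sum_{C \in \mathscr{C}_{i-1}} x_C \left( x_{C^+} - x_C \right) = \frac{k(k-1)}{v-1} (e_i - 1) \prod_{j \leq i-1} e_j \quad \text{for each } i \in \{2, \ldots, s\}.$$ Furthermore, if (A) and (B) are satisfied,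 then the quantities in each of the equalities in (A) and (B) are even integers, and $v-1$ divides $\binom{k}{2} \cdot \gcd(e_1-1,\dots, e_s-1)$.
   Context: A $2$-design is a pair $\mathscr{D}=(\mathscr{P},\mathscr{B})$ with $\mathscr{P}$ a set of $v$ points and $\mathscr{B}$ a set of $k$-element subsets of $\mathscr{P}$ (blocks), such that every set of $2$ distinct points is contained in exactly $\lambda$ blocks, for some constant $\lambda$. An automorphism of $\mathscr{D}$ is a permutation of $\mathscr{P}$ preserving $\mathscr{B}$. $\mathscr{D}$ is $G$-block-transitive if $G\leq \mathrm{Aut}(\mathscr{D})$ is transitive on $\mathscr{B}$. For partitions of $\mathscr{P}$, $\mathscr{C}'\prec\mathscr{C}$ means that each part of $\mathscr{C}'$ is a subset of some part of $\mathscr{C}$ with at least one inclusion proper. For $s\ge 2$, $G\leq\mathrm{Sym}(\mathscr{P})$ is $s$-chain-imprimitive on $\mathscr{P}$ if $G$ is transitive on $\mathscr{P}$ and there exist $G$-invariant partitions $\mathscr{C}_0\prec\mathscr{C}_1\prec\cdots\prec\mathscr{C}_s$ with $\mathscr{C}_0$ the partition into singletons and $\mathscr{C}_s=\{\mathscr{P}\}$. A design $\mathscr{D}$ with point set $\mathscr{P}$ is $(G,s)$-chain-imprimitive if $G\leq \mathrm{Aut}(\mathscr{D})$ acts $s$-chain-imprimitively on $\mathscr{P}$. The stabiliser of a chain consists of all permutations of $\mathscr{P}$ that leave each partition $\mathscr{C}_i$ invariant (map classes of $\mathscr{C}_i$ to classes of $\mathscr{C}_i$). *)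

(* Defs.v *)
From mathcomp Require Import all_boot all_order all_algebra all_fingroup.
Set Implicit Arguments.
Unset Strict Implicit.
Unset Printing Implicit Defensive.
Import GRing.Theory Num.Theory.
Local Open Scope ring_scope.

(* A design on the finite point set T is given by its set of blocks.  'P^*
   is the action of {perm T} on {set T} by images; 'N(D | 'P^* ) is the group
   of all permutations mapping members of D to members of D. *)

Definition two_design (T : finType) (D : {set {set T}}) : Prop :=
  exists k lam : nat,
    (forall b, b \in D -> #|b| = k) /\
    (forall A : {set T}, #|A| = 2%N -> #|[set b in D | A \subset b]| = lam).

Definition design_aut (T : finType) (D : {set {set T}}) : {group {perm T}} :=
  'N(D | 'P^* )%G.

Definition block_transitive (T : finType) (G : {group {perm T}})
    (D : {set {set T}}) : Prop :=
  G \subset design_aut D /\ [transitive G, on D | 'P^* ].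

Definition prec (T : finType) (Q' Q : {set {set T}}) : Prop :=
  (forall A, A \in Q' -> exists2 E, E \in Q & A \subset E) /\
  (exists A E : {set T}, [/\ A \in Q', E \in Q & A \proper E]).

(* Only the values C 0, ..., C s of the sequence are constrained. *)
Definition partition_chain (T : finType) (s : nat)
    (C : nat -> {set {set T}}) : Prop :=
  [/\ forall i, (i <= s)%N -> partition (C i) [set: T],
      C 0%N = [set [set x] | x in T],
      C s = [set [set: T]] &
      forall i, (i < s)%N -> prec (C i) (C i.+1)].

Definition chain_imprimitive (T : finType) (G : {group {perm T}})
    (s : nat) : Prop :=
  [/\ (2 <= s)%N,
      [transitive G, on [set: T] | 'P] &
      exists2 C : nat -> {set {set T}},
        partition_chain s C &
        forall i, (i <= s)%N -> G \subset 'N(C i | 'P^* )%g].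

Definition chain_imprimitive_design (T : finType) (G : {group {perm T}})
    (s : nat) (D : {set {set T}}) : Prop :=
  G \subset design_aut D /\ chain_imprimitive G s.

Definition chain_stabiliser (T : finType) (s : nat)
    (C : nat -> {set {set T}}) : {group {perm T}} :=
  (\bigcap_(i < s.+1) 'N(C i | 'P^* ))%G.

(* The class of the partition Q containing A, i.e. A^+ when Q is the next
   partition of the chain; set0 is a dummy value for when there is none. *)
Definition class_above (T : finType) (Q : {set {set T}}) (A : {set T}) :
    {set T} :=
  odflt set0 [pick E in Q | A \subset E].

Definition xcount (T : finType) (B A : {set T}) : rat := #|B :&: A|%:R.

Definition lhsA (T : finType) (C : nat -> {set {set T}}) (B : {set T}) : rat :=
  \sum_(A in C 1%N) xcount B A * (xcount B A - 1).

Definition rhsA (e : nat -> nat) (v k : nat) : rat :=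
  (k%:R * (k%:R - 1)) / (v%:R - 1) * ((e 1%N)%:R - 1).

Definition lhsB (T : finType) (C : nat -> {set {set T}}) (B : {set T})
    (i : nat) : rat :=
  \sum_(A in C i.-1)
    xcount B A * (xcount B (class_above (C i) A) - xcount B A).

Definition rhsB (e : nat -> nat) (v k i : nat) : rat :=
  (k%:R * (k%:R - 1)) / (v%:R - 1) * ((e i)%:R - 1)
    * \prod_(1 <= j < i) (e j)%:R.

Definition even_integer (q : rat) : Prop := exists m : int, q = (2 * m)%:~R.

(* Main.v *)
Require Import Defs.
From mathcomp Require Import all_boot all_order all_algebra all_fingroup.
From mathcomp Require Import ring.

(* Say that two points are at level i when i is minimal such that they lie in
   the same class of C_i.  The group G is transitive on the pairs at a given
   level: a labelling of the classes of each C_(i-1) inside a class of C_i gives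
   coordinates on the points, and coordinatewise injections, each depending on
   the higher coordinates only, assemble to elements of G.  Hence the number of
   blocks through a pair depends only on its level i, and by double counting it
   is |D| N_i / O_i, where N_i and O_i are the numbers of ordered pairs at level
   i in B and in the whole point set.  So D is a 2-design iff N_i / O_i does not
   depend on i; equations (A) and (B) say just that.  Since N_i is a difference
   of sums of squares of block intersections, which all have the form
   k + 2 (sum of binomials), it is even; and v - 1 is prime to the products of
   the e_j because these divide v. *)

Set Implicit Arguments.
Unset Strict Implicit.
Unset Printing Implicit Defensive.
Import GRing.Theory Num.Theory.
Local Open Scope ring_scope.

(** * Injections on labels with one or two prescribed values *)

Section Swap.
Local Open Scope nat_scope.

Definition swap (a b n : nat) : nat :=
  if n == a then b else if n == b then a else n.

Lemma swap_inj a b : injective (swap a b).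
Proof.
move=> m n; rewrite /swap.
by case: (m =P a); case: (m =P b); case: (n =P a); case: (n =P b); congruence.
Qed.

Lemma swapL a b : swap a b a = b.
Proof. by rewrite /swap eqxx. Qed.

Lemma swap_neq a b n : n != a -> n != b -> swap a b n = n.
Proof. by rewrite /swap => /negbTE-> /negbTE->. Qed.

Lemma swap_lt d a b n : a < d -> b < d -> n < d -> swap a b n < d.
Proof. by rewrite /swap; case: eqP => // _; case: eqP. Qed.

(* The injection sending [a] to [a'] and [b] to [b'] (see [swap2L]). *)
Definition swap2 (a a' b b' n : nat) : nat :=
  swap (swap a a' b) b' (swap a a' n).

Lemma swap2_inj a a' b b' : injective (swap2 a a' b b').
Proof. exact: inj_comp (@swap_inj _ _) (@swap_inj _ _). Qed.

Lemma swap2R a a' b b' : swap2 a a' b b' b = b'.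
Proof. exact: swapL. Qed.

(** After the first swap [a] sits at [a']. The second one fixes [a']: it is trivial if [a = b], and
    otherwise exchanges two values distinct from [a']. *)
Lemma swap2L a a' b b' : (a == b) = (a' == b') -> swap2 a a' b b' a = a'.
Proof.
rewrite /swap2 swapL; case: (eqVneq a b) => [<- /esym/eqP <- | ab /esym/negbT ab'].
  by rewrite !swapL.
rewrite swap_neq //; apply: contraNneq ab => a'E.
by apply/eqP/(@swap_inj a a'); rewrite swapL.
Qed.

Lemma swap2_lt d a a' b b' n :
  a < d -> a' < d -> b < d -> b' < d -> n < d -> swap2 a a' b b' n < d.
Proof. by move=> *; do !apply: swap_lt. Qed.

End Swap.

(** * Double counting of pairs and blocks *)

Definition pair_count (T : finType) (P : {set T * T}) (b : {set T}) : nat :=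
  #|setX b b :&: P|.

(** Both sides count the incidences of pairs in [P] with blocks containing both entries. *)
Lemma sum_pair_count (T : finType) (P : {set T * T}) (D : {set {set T}}) :
  (\sum_(b in D) pair_count P b
    = \sum_(p in P) #|[set b in D | [set p.1; p.2] \subset b]|)%N.
Proof.
under eq_bigr do rewrite /pair_count -sum1_card big_mkcond /=.
under [RHS]eq_bigr do rewrite -sum1_card big_mkcond /=.
rewrite exchange_big [RHS]big_mkcond /=; apply: eq_bigr => -[x y] _ /=.
case: ifP => xyP; last by rewrite big1 // => b _; rewrite !inE xyP andbF.
rewrite [LHS]big_mkcond; apply: eq_bigr => b _.
by rewrite !inE subUset !sub1set xyP andbT; case: (b \in D).
Qed.

Lemma pair_count_perm (T : finType) (P : {set T * T}) (g : {perm T}) (b : {set T}) :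
    (forall x y, ((g x, g y) \in P) = ((x, y) \in P)) ->
  pair_count P ('P^*%act b g) = pair_count P b.
Proof.
move=> gP; have h_inj : injective (fun p : T * T => (g p.1, g p.2)).
  by move=> [x y] [x' y'] /= [/perm_inj-> /perm_inj->].
rewrite /pair_count -[RHS](card_imset _ h_inj); apply: eq_card => -[x y].
rewrite -(permKV g x) -(permKV g y).
rewrite -[X in _ = X]/(_ \in _ @: _) (mem_imset _ (_, _) h_inj) !inE /= gP.
by rewrite !mem_imset //; apply: perm_inj.
Qed.

(** * The chain as nested relations, and coordinates on the points *)

Section Chain.

Variables (T : finType) (s : nat) (e : nat -> nat) (C : nat -> {set {set T}}).
Hypothesis hC : partition_chain s C.
Hypothesis hCe : forall i, (1 <= i <= s)%N -> forall A, A \in C i ->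
  #|[set E in C i.-1 | E \subset A]| = e i.

Definition eqv i x y := y \in pblock (C i) x.

Lemma chain_partition i : (i <= s)%N -> partition (C i) [set: T].
Proof. by case: hC => + _ _ _; apply. Qed.

Lemma chain_triv i : (i <= s)%N -> trivIset (C i).
Proof. by case/chain_partition/and3P. Qed.

Lemma chain_cover i x : (i <= s)%N -> x \in cover (C i).
Proof. by case/chain_partition/and3P => /eqP-> _ _; rewrite inE. Qed.

Lemma pblock_chain i x : (i <= s)%N -> pblock (C i) x \in C i.
Proof. by move=> ?; apply/pblock_mem/chain_cover. Qed.

Lemma eqv_refl i x : (i <= s)%N -> eqv i x x.
Proof. by move=> ?; rewrite /eqv mem_pblock chain_cover. Qed.

Lemma eqvE i x y : (i <= s)%N -> eqv i x y = (pblock (C i) x == pblock (C i) y).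
Proof. by move=> ?; rewrite eq_pblock ?chain_triv ?chain_cover. Qed.

Lemma chain_def i A x : (i <= s)%N -> A \in C i -> x \in A -> pblock (C i) x = A.
Proof. by move=> ?; apply/def_pblock/chain_triv. Qed.

Lemma chain_ex i A : (i <= s)%N -> A \in C i -> exists x, x \in A.
Proof.
by move=> ? ?; apply/set0Pn/(partition_neq0 (chain_partition _)); eassumption.
Qed.

Lemma eqv0 x y : eqv 0 x y = (x == y).
Proof.
rewrite /eqv (@chain_def 0 [set x] x) ?inE 1?eq_sym //.
by case: hC => _ -> _ _; apply/imsetP; exists x; rewrite ?inE.
Qed.

Lemma eqvs x y : eqv s x y.
Proof.
by case: hC => _ _ Cs _; rewrite /eqv (@chain_def s setT) ?Cs ?inE.
Qed.

Lemma eqvS i x y : (i < s)%N -> eqv i x y -> eqv i.+1 x y.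
Proof.
move=> lis xy; have ltis := ltnW lis.
have [A AC sub] : exists2 A, A \in C i.+1 & pblock (C i) x \subset A.
  by case: hC => _ _ _ /(_ i lis) [+ _]; apply; apply: pblock_chain.
rewrite /eqv (@chain_def i.+1 A x) ?(subsetP sub) //.
exact: eqv_refl.
Qed.

Lemma eqv_le i j x y : (i <= j <= s)%N -> eqv i x y -> eqv j x y.
Proof.
case/andP=> /subnK <-; elim: (j - i)%N => [//|d IH] ltds /IH xy.
by apply: eqvS => //; apply: xy; apply: ltnW.
Qed.

(* Coordinates on [T]: the position of the [C i]-class of [x] among the
   [e i.+1] classes contained in its [C i.+1]-class. *)
Definition children i (A : {set T}) : seq {set T} :=
  enum [set E in C i | E \subset A].

Definition label i x : nat :=
  index (pblock (C i) x) (children i (pblock (C i.+1) x)).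

Lemma mem_children i x : (i < s)%N ->
  pblock (C i) x \in children i (pblock (C i.+1) x).
Proof.
move=> lis; rewrite mem_enum inE pblock_chain 1?ltnW //=.
by apply/subsetP=> y; apply: eqvS.
Qed.

Lemma size_children i A : (i < s)%N -> A \in C i.+1 -> size (children i A) = e i.+1.
Proof. by move=> lis AC; rewrite -cardE (@hCe i.+1). Qed.

Lemma label_lt i x : (i < s)%N -> (label i x < e i.+1)%N.
Proof.
move=> lis; rewrite -(size_children lis (pblock_chain x lis)).
by rewrite index_mem mem_children.
Qed.

(** Classes inside a common [C i.+1]-class are looked up in the same list, where the index
    determines the entry. *)
Lemma label_eq i x y : (i < s)%N -> eqv i.+1 x y ->
  (label i x == label i y) = eqv i x y.
Proof.
move=> lis xy; have lis' := ltnW lis; rewrite eqvE // /label.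
have xyE : pblock (C i.+1) x = pblock (C i.+1) y by apply/eqP; rewrite -eqvE.
rewrite xyE; apply/eqP/eqP => [|-> //].
apply: (index_inj set0); last exact: mem_children.
by rewrite -xyE mem_children.
Qed.

(** The coordinates are set from the top down: entering child number [c i] of the current class
    keeps the higher labels. The argument in [T] is the starting point. *)
Lemma label_ex (c : nat -> nat) : (forall i, (i < s)%N -> (c i < e i.+1)%N) ->
  T -> exists x, forall i, (i < s)%N -> label i x = c i.
Proof.
move=> hc x0.
suff H d : (d <= s)%N -> exists x, forall i, (s - d <= i < s)%N -> label i x = c i.
  by case: (H s (leqnn s)) => x hx; exists x => i lis; apply: hx; rewrite subnn lis.
elim: d => [_|d IH lds].
  by exists x0 => i; rewrite subn0 ltnNge => /andP[->].
have [x hx] := IH (ltnW lds).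
set i := (s - d.+1)%N; have iS : i.+1 = (s - d)%N by rewrite /i subnSK.
have lis : (i < s)%N by rewrite iS leq_subr.
set A := pblock (C i.+1) x; have AC : A \in C i.+1 by apply: pblock_chain.
set E := nth set0 (children i A) (c i).
have szi : (c i < size (children i A))%N by rewrite size_children // hc.
have /[!mem_enum] := mem_nth set0 szi; rewrite -/E inE => /andP[EC EA].
have [y yE] := chain_ex (ltnW lis) EC.
have yA : pblock (C i.+1) y = A by apply: chain_def => //; apply: (subsetP EA).
exists y => j /andP[]; rewrite leq_eqVlt => /predU1P[<- _|ltij ljs].
  by rewrite /label yA (chain_def (ltnW lis) EC yE) index_uniq ?enum_uniq.
rewrite -hx ?ljs -?iS ?ltij //; apply/eqP.
have yx : eqv i.+1 y x by rewrite eqvE // yA.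
rewrite label_eq //; apply: (@eqv_le i.+1) => //; rewrite ?ltij ?ljs //.
  exact: ltnW.
by rewrite (leq_trans ltij) // ltnW.
Qed.

(** Equal labels lead from the single class of [C s] down to the singletons of [C 0]. *)
Lemma label_inj x y : (forall i, (i < s)%N -> label i x = label i y) -> x = y.
Proof.
move=> xy; apply/eqP; rewrite -eqv0 -(subnn s).
suff H d : (d <= s)%N -> eqv (s - d) x y by apply: H.
elim: d => [|d IH lds]; first by rewrite subn0 eqvs.
have := IH (ltnW lds); rewrite -subnSK // => xyS.
have lis : (s - d.+1 < s)%N by rewrite subnSK // leq_subr.
by rewrite -label_eq // xy.
Qed.

(** * The stabiliser of the chain and its transitivity on pairs *)

Lemma mem_stabP (g : {perm T}) :
  reflect (forall i x y, (i <= s)%N -> eqv i (g x) (g y) = eqv i x y)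
          (g \in chain_stabiliser s C).
Proof.
apply: (iffP idP) => [/bigcapP gC i x y lis | gE].
  have /astabsP gCi := gC (Ordinal (lis : i < s.+1)%N) isT.
  have : pblock (C i) (g x) = [set g z | z in pblock (C i) x].
    apply: chain_def => //; last by apply/imsetP; exists x => //; apply: eqv_refl.
    by have /= := gCi (pblock (C i) x); rewrite pblock_chain.
  by rewrite /eqv => ->; rewrite mem_imset //; apply: perm_inj.
apply/bigcapP => -[i /= lis] _; rewrite ltnS in lis.
rewrite /astabs !inE /=; apply/subsetP => A AC; rewrite inE /=.
have [x xA] := chain_ex lis AC.
suff <- : pblock (C i) (g x) = 'P^*%act A g by apply: pblock_chain.
apply/setP=> y; rewrite -(permKV g y) mem_imset; last exact: perm_inj.
by rewrite -(chain_def lis AC xA); apply: gE.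
Qed.

(* An element of the iterated wreath product: on the coordinate [i] it acts by
   a permutation depending on the [C i.+1]-class only. *)
Lemma label_perm (f : nat -> T -> nat -> nat) :
    (forall i x, (i < s)%N -> injective (f i x)) ->
    (forall i x n, (i < s)%N -> (n < e i.+1)%N -> (f i x n < e i.+1)%N) ->
    (forall i x y, (i < s)%N -> eqv i.+1 x y -> f i x =1 f i y) ->
  exists2 g, g \in chain_stabiliser s C &
    forall i x, (i < s)%N -> label i (g x) = f i x (label i x).
Proof.
move=> f_inj f_lt f_eqv.
have /fin_all_exists[h hE] x :
    exists y, forall i, (i < s)%N -> label i y = f i x (label i x).
  by apply: label_ex => // i lis; apply: f_lt => //; apply: label_lt.
(* Downward induction: inside one [C i.+1]-class a single injection acts on the labels, so
   [C i]-classes are neither merged nor split. Level 0 then gives injectivity of [h]. *)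
have h_eqv i x y : (i <= s)%N -> eqv i (h x) (h y) = eqv i x y.
  move/subKn <-; elim: (s - i)%N (leq_subr i s) => [|d IH lds].
    by rewrite subn0 !eqvs.
  have lis : (s - d.+1 < s)%N by rewrite subnSK // leq_subr.
  have := IH (ltnW lds); rewrite -subnSK // => xyS.
  have [xy|nxy] := boolP (eqv (s - d.+1).+1 x y); last first.
    by apply/idP/idP => /(eqvS lis); rewrite ?xyS (negPf nxy).
  rewrite -(label_eq lis xy) -(label_eq lis) ?xyS // !hE // -(f_eqv _ x y) //.
  by rewrite inj_eq //; apply: f_inj.
have h_inj : injective h by move=> x y /eqP; rewrite -eqv0 h_eqv // eqv0 => /eqP.
exists (perm h_inj) => [|i x lis]; last by rewrite permE hE.
by apply/mem_stabP => i x y lis; rewrite !permE h_eqv.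
Qed.

Lemma eqv_sym i x y : (i <= s)%N -> eqv i x y = eqv i y x.
Proof. by move=> lis; rewrite !eqvE // eq_sym. Qed.

Lemma eqv_trans i x y z : (i <= s)%N -> eqv i x y -> eqv i z x = eqv i z y.
Proof. by move=> lis; rewrite !eqvE // => /eqP->. Qed.

Lemma stab_trans2 x y x' y' :
    (forall i, (i <= s)%N -> eqv i x y = eqv i x' y') ->
  exists2 g, g \in chain_stabiliser s C & g x = x' /\ g y = y'.
Proof.
move=> xy.
(* In a [C i.+1]-class containing both points both labels are prescribed, compatibly by the
   hypothesis at levels [i] and [i.+1]. The last branch serves the class of [y] and is an arbitrary
   choice elsewhere. *)
pose f i z :=
  if eqv i.+1 z x then
    if eqv i.+1 z y then swap2 (label i x) (label i x') (label i y) (label i y')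
    else swap (label i x) (label i x')
  else swap (label i y) (label i y').
have [|||g gC gE] := @label_perm f.
- move=> i z _; rewrite /f; case: ifP => _; last exact: swap_inj.
  by case: ifP => _; [exact: swap2_inj | exact: swap_inj].
- move=> i z n lis nlt; rewrite /f.
  by do 2?case: ifP => _; rewrite ?swap2_lt ?swap_lt ?label_lt.
- move=> i z w lis zw n; rewrite /f.
  by rewrite !(eqv_sym z) // !(eqv_sym w) // -!(eqv_trans _ lis zw).
exists g => //; split; apply: label_inj => i lis; rewrite gE // /f.
- rewrite eqv_refl //; case: ifP => [xyS|_]; last exact: swapL.
  by apply: swap2L; rewrite !label_eq -?xy // ltnW.
- rewrite eqv_refl // eqv_sym //.
  by case: ifP => _; [exact: swap2R | exact: swapL].
Qed.


(** * Pair counts as sums over classes *)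

Lemma sum_over_classes i b (F : {set T} -> rat) : (i <= s)%N ->
  \sum_(A in C i) xcount b A * F A = \sum_(x in b) F (pblock (C i) x).
Proof.
move=> lis; rewrite (partition_big (pblock (C i)) (mem (C i))) /=; last first.
  by move=> x _; apply: pblock_chain.
apply: eq_bigr => A AC.
rewrite (eq_bigr (fun=> F A)) => [|x /andP[_ /eqP-> //]].
rewrite sumr_const mulr_natl; congr (_ *+ _); apply: eq_card => x.
rewrite inE [RHS]unfold_in; case: (x \in b) => //=.
apply/idP/eqP => [/(chain_def lis AC) // | <-]; exact: eqv_refl.
Qed.

Definition eqv_pairs i : {set T * T} := [set p | eqv i p.1 p.2].
(* The left-hand sides of the equations are consecutive differences of
   [moment i b], the sum of [x_A ^ 2] over the classes [A] of [C i]. *)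
Definition moment i b : rat := (pair_count (eqv_pairs i) b)%:R.
(** For [i = j.+1] these are the pairs at level [i]; the general form also covers all pairs of
    distinct points, as [level 0 s]. *)
Definition level j i := eqv_pairs i :\: eqv_pairs j.

Lemma moment_sum i b :
  moment i b = \sum_(x in b) xcount b (pblock (C i) x).
Proof.
rewrite /moment /pair_count -sum1_card.
rewrite (eq_bigl (fun p => (p.1 \in b) && ((p.2 \in b) && eqv i p.1 p.2))); last first.
  by move=> p; rewrite !inE andbA.
rewrite -(pair_big_dep (mem b) (fun x y => (y \in b) && eqv i x y) (fun _ _ => 1%N)) /=.
rewrite natr_sum; apply: eq_bigr => x _.
rewrite sum1_card; by congr (_%:R); apply: eq_card => y; rewrite !inE.
Qed.

Lemma moment_sq i b : (i <= s)%N ->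
  moment i b = \sum_(A in C i) xcount b A ^+ 2.
Proof. by move=> lis; rewrite moment_sum -sum_over_classes. Qed.

Lemma moment0 b : moment 0 b = #|b|%:R.
Proof.
rewrite moment_sum -sum1_card natr_sum; apply: eq_bigr => x xb.
rewrite /xcount -(cards1 x); congr (_%:R); apply: eq_card => y.
rewrite !inE [y \in pblock _ _]eqv0 eq_sym.
by case: eqP => [->|]; rewrite ?xb ?andbF.
Qed.

Lemma moments b : moment s b = #|b|%:R ^+ 2.
Proof.
rewrite /moment /pair_count expr2 -natrM -cardsX; congr (_%:R).
by apply: eq_card => p; rewrite !inE eqvs andbT.
Qed.

Lemma level_count j i b : (j <= i <= s)%N ->
  (pair_count (level j i) b)%:R = moment i b - moment j b.
Proof.
move=> jis; apply/eqP; rewrite eq_sym subr_eq -natrD; apply/eqP.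
congr (_%:R); rewrite /pair_count /level setIDA addnC.
rewrite -(cardsID (eqv_pairs j) (_ :&: eqv_pairs i)); congr (_ + _)%N.
apply: eq_card => p; rewrite !inE -andbA; congr (_ && _).
by apply/andP/idP => [[] //|ji]; rewrite ji (eqv_le jis).
Qed.

Lemma class_aboveE i x : (i < s)%N ->
  class_above (C i.+1) (pblock (C i) x) = pblock (C i.+1) x.
Proof.
move=> lis; rewrite /class_above; case: pickP => [E /andP[EC sub] | none] /=.
  by rewrite (chain_def lis EC) // (subsetP sub) //; apply: eqv_refl; apply: ltnW.
have := none (pblock (C i.+1) x); rewrite pblock_chain //= => /negP[].
by apply/subsetP=> y; apply: eqvS.
Qed.

(** Summed over the points of [b], x_{A^+} counts the pairs in a common [C i.+1]-class and x_A those
    in a common [C i]-class. *)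
Lemma lhsB_moment b i : (i < s)%N -> lhsB C b i.+1 = moment i.+1 b - moment i b.
Proof.
move=> lis; rewrite /lhsB /= (sum_over_classes _
  (fun A => xcount b (class_above (C i.+1) A) - xcount b A)) 1?ltnW //.
by rewrite !moment_sum -sumrB; apply: eq_bigr => x _; rewrite class_aboveE.
Qed.

(** The x_A add up to the size of [b], which is [moment 0 b]; so (A) continues the pattern of (B) to
    i = 1. *)
Lemma lhsA_moment b : (0 < s)%N -> lhsA C b = moment 1 b - moment 0 b.
Proof.
move=> s0; rewrite /lhsA (sum_over_classes _ (fun A => xcount b A - 1)) //.
by rewrite sumrB moment0 moment_sum sumr_const.
Qed.

(** * Sizes of classes and levels *)

Definition class_size i : nat := (\prod_(1 <= j < i.+1) e j)%N.

Lemma class_size0 : class_size 0 = 1%N.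
Proof. by rewrite /class_size big_geq. Qed.

Lemma class_sizeS i : class_size i.+1 = (e i.+1 * class_size i)%N.
Proof. by rewrite /class_size big_nat_recr //= mulnC. Qed.

(** By induction, a [C i.+1]-class is partitioned into [e i.+1] subclasses of equal size. *)
Lemma card_class i A : (i <= s)%N -> A \in C i -> #|A| = class_size i.
Proof.
elim: i A => [|i IH] A lis AC.
  by case: hC AC => _ -> _ _ /imsetP[x _ ->]; rewrite cards1 class_size0.
have lis' := ltnW lis.
rewrite class_sizeS -(@hCe i.+1 _ A) //=.
apply: card_uniform_partition => [E|]; first by rewrite inE => /andP[/IH->].
apply/and3P; split.
- apply/eqP/setP=> x; apply/bigcupP/idP => [[E]|xA].
    by rewrite inE => /andP[_ /subsetP]; apply.
  exists (pblock (C i) x); last exact: eqv_refl.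
  rewrite inE pblock_chain //= -(chain_def lis AC xA).
  by apply/subsetP=> y; apply: eqvS.
- apply: trivIsetS (chain_triv lis').
  by apply/subsetP=> E; rewrite inE => /andP[].
- by rewrite inE; case/and3P: (chain_partition lis') => _ _ /negPf->.
Qed.

Lemma moment_setT i : (i <= s)%N -> moment i [set: T] = #|T|%:R * (class_size i)%:R.
Proof.
move=> lis; rewrite moment_sum mulr_natl -cardsT -sumr_const.
by apply: eq_bigr => x _; rewrite /xcount setTI (@card_class i) // pblock_chain.
Qed.

(** The whole point set is taken as the block in [level_count]. *)
Lemma card_level j i : (j <= i <= s)%N ->
  #|level j i|%:R = #|T|%:R * ((class_size i)%:R - (class_size j)%:R) :> rat.
Proof.
move=> jis; have /andP[ji lis] := jis; have ljs := leq_trans ji lis.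
rewrite mulrBr -!moment_setT // -level_count // /pair_count.
by congr (_%:R); apply: eq_card => p; rewrite !inE.
Qed.

(** * Blocks of the orbit through a pair of points *)

Variable B : {set T}.
Let G := chain_stabiliser s C.
Let D := orbit 'P^*%act G B.

Definition cover_count (x y : T) : nat := #|[set b in D | [set x; y] \subset b]|.

Lemma mem_block b : reflect (exists2 g, g \in G & b = 'P^*%act B g) (b \in D).
Proof. by apply: (iffP orbitP) => -[g ? E]; exists g. Qed.

Lemma card_block b : b \in D -> #|b| = #|B|.
Proof. by case/mem_block=> g _ ->; rewrite card_imset //; apply: perm_inj. Qed.

Lemma level_count_block j i b : (j <= i <= s)%N -> b \in D ->
  pair_count (level j i) b = pair_count (level j i) B.
Proof.
case/andP=> ji lis /mem_block[g /mem_stabP gE ->]; apply: pair_count_perm => x y.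
by rewrite !inE /= !gE // (leq_trans ji).
Qed.

Lemma sum_cover_count j i : (j <= i <= s)%N ->
  \sum_(p in level j i) (cover_count p.1 p.2)%:R
    = #|D|%:R * (moment i B - moment j B) :> rat.
Proof.
move=> jis; rewrite -natr_sum -sum_pair_count -level_count // -natrM.
congr (_%:R); rewrite -sum_nat_const; apply: eq_bigr => b bD.
exact: level_count_block.
Qed.

Lemma cover_count_perm g x y : g \in G ->
  cover_count (g x) (g y) = cover_count x y.
Proof.
move=> gG; rewrite /cover_count -[LHS]sum1_card -[RHS]sum1_card.
rewrite (reindex_inj (act_inj 'P^* g)); apply: eq_bigl => b.
rewrite !inE !subUset !sub1set; congr (_ && (_ && _)).
- by apply: (acts_act (acts_orbit _ _ (subsetT _))).
- by rewrite mem_imset //; apply: perm_inj.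
- by rewrite mem_imset //; apply: perm_inj.
Qed.

(** The level of a pair decides all its relations, as [stab_trans2] requires. *)
Lemma level_eqv i j p : (i < s)%N -> (j <= s)%N -> p \in level i i.+1 ->
  eqv j p.1 p.2 = (i < j)%N.
Proof.
move=> lis ljs; rewrite !inE => /andP[ni iS]; case: ltnP => [ij|ji].
  by apply: eqv_le iS; rewrite ij.
by apply: contraNF ni; apply: eqv_le; rewrite ji ltnW.
Qed.

Lemma cover_count_level i p q : (i < s)%N -> p \in level i i.+1 ->
  q \in level i i.+1 -> cover_count p.1 p.2 = cover_count q.1 q.2.
Proof.
move=> lis pl ql.
have [|g gG [<- <-]] := @stab_trans2 p.1 p.2 q.1 q.2; last first.
  by rewrite cover_count_perm.
by move=> j ljs; rewrite !(level_eqv lis).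
Qed.

Lemma level_ex x y : x != y -> exists2 i, (i < s)%N & (x, y) \in level i i.+1.
Proof.
move=> xy; have ex : exists i, eqv i x y by exists s; apply: eqvs.
(* The minimal index is not 0 because the points differ, hence it is a successor. *)
case: (ex_minnP ex) => -[|i] Ei mini; first by rewrite -eqv0 Ei in xy.
exists i; first exact: mini (eqvs _ _).
by rewrite !inE /= Ei andbT; apply/negP => /mini; rewrite ltnn.
Qed.

(** * The design property in terms of moments *)

Hypothesis he : forall i, (1 <= i <= s)%N -> (2 <= e i)%N.
Hypothesis hT : #|T| = class_size s.
Hypothesis hs : (0 < s)%N.

Lemma class_size_gt0 i : (i <= s)%N -> (0 < class_size i)%N.
Proof.
elim: i => [|i IH] lis; first by rewrite class_size0.
by rewrite class_sizeS muln_gt0 (IH (ltnW lis)) andbT; apply/ltnW/he.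
Qed.

Lemma class_size_lt i : (i < s)%N -> (class_size i < class_size i.+1)%N.
Proof.
move=> lis; rewrite class_sizeS ltn_Pmull ?class_size_gt0 ?he //; exact: ltnW.
Qed.

Lemma class_size_top : (1 < class_size s)%N.
Proof.
have := class_size_lt (i := s.-1); rewrite prednK // => /(_ (leqnn _)).
by apply: leq_ltn_trans; rewrite class_size_gt0 // leq_pred.
Qed.

(** The factor k(k-1)/(v-1) common to all right-hand sides: v times the proportion of ordered pairs
    of distinct points that lie in [B]. *)
Definition pair_ratio : rat :=
  (#|B|%:R * (#|B|%:R - 1)) / ((class_size s)%:R - 1).

Lemma D_gt0 : 0 < #|D|%:R :> rat.
Proof. by rewrite ltr0n; apply/card_gt0P; exists B; apply: orbit_refl. Qed.

Lemma T_gt0 : 0 < #|T|%:R :> rat.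
Proof. by rewrite ltr0n hT ltnW // class_size_top. Qed.

Lemma top_gt1 : 0 < (class_size s)%:R - 1 :> rat.
Proof. by rewrite subr_gt0 ltr1n class_size_top. Qed.

Lemma two_design_moment :
  two_design D <-> forall i, (i < s)%N ->
    moment i.+1 B - moment i B
      = pair_ratio * ((class_size i.+1)%:R - (class_size i)%:R).
Proof.
have D0 := lt0r_neq0 D_gt0; have T0 := lt0r_neq0 T_gt0.
have v0 := lt0r_neq0 top_gt1.
split=> [[k [lam [_ hlam]]] | hM].
  have E j i : (j <= i <= s)%N -> #|D|%:R * (moment i B - moment j B)
      = lam%:R * (#|T|%:R * ((class_size i)%:R - (class_size j)%:R)).
    move=> jis; rewrite -sum_cover_count // -card_level //.
    rewrite -natr_sum -natrM mulnC -sum_nat_const; congr (_%:R).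
    apply: eq_bigr => -[x y]; rewrite !inE => /andP[/= nxy _].
    apply: hlam; rewrite cards2; case: eqP nxy => // <-.
    by rewrite eqv_refl //; case/andP: jis; apply: leq_trans.
  (* All pairs of distinct points at once: |D| k(k-1) = lam v(v-1), which serves to eliminate
     [lam]. *)
  have := E 0%N s; rewrite leqnn moments moment0 class_size0 => /(_ isT) E0.
  move=> i lis; apply: (mulfI D0); rewrite E ?leqnSn //.
  apply: (mulfI v0); rewrite /pair_ratio.
  transitivity (#|D|%:R * (#|B|%:R ^+ 2 - #|B|%:R)
    * ((class_size i.+1)%:R - (class_size i)%:R) : rat).
    by rewrite E0; ring.
  by field.
(* The value that |D| N_i / O_i takes at every level once the difference of class sizes cancels. *)
pose c := #|D|%:R * pair_ratio / #|T|%:R.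
have cE x y : x != y -> (cover_count x y)%:R = c.
  case/level_ex=> i lis xyl; have := sum_cover_count (j := i) (i := i.+1).
  rewrite leqnSn => /(_ lis).
  rewrite (eq_bigr (fun=> (cover_count x y)%:R)); last first.
    by move=> p pl; rewrite (cover_count_level lis pl xyl).
  rewrite sumr_const -[_ *+ #|_|]mulr_natr card_level ?leqnSn // hM //.
  have m0 : (class_size i.+1)%:R - (class_size i)%:R != 0 :> rat.
    by rewrite lt0r_neq0 // subr_gt0 ltr_nat class_size_lt.
  move=> E; apply: (mulIf m0); apply: (mulIf T0); rewrite /c.
  by rewrite [LHS]mulrAC -[LHS]mulrA E; field.
(* As [c] is only rational, the natural number lambda is read off from some pair of distinct
   points. *)
have [x [y [_ _ xy]]] : exists x y, [/\ x \in T, y \in T & x != y].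
  by apply/card_gt1P; rewrite hT class_size_top.
exists #|B|; exists (cover_count x y).
split; first exact: card_block.
move=> A /eqP/cards2P[z [w [zw ->]]].
by apply/eqP; rewrite -/(cover_count z w) -(eqr_nat rat) !cE.
Qed.

Lemma rhsA_ratio :
  rhsA e (class_size s) #|B| = pair_ratio * ((class_size 1)%:R - (class_size 0)%:R).
Proof. by rewrite class_sizeS class_size0 muln1. Qed.

Lemma rhsB_ratio i : rhsB e (class_size s) #|B| i.+1
  = pair_ratio * ((class_size i.+1)%:R - (class_size i)%:R).
Proof.
rewrite /rhsB -natr_prod -/(class_size i) -/pair_ratio class_sizeS natrM.
by rewrite -mulrA mulrBl mul1r.
Qed.

(** With the index shifted by one, (A) is the case [i = 0] and (B) gives the cases [i > 0]. *)
Lemma equations_moment :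
  (lhsA C B = rhsA e (class_size s) #|B| /\
   forall i, (2 <= i <= s)%N -> lhsB C B i = rhsB e (class_size s) #|B| i) <->
  forall i, (i < s)%N -> moment i.+1 B - moment i B
      = pair_ratio * ((class_size i.+1)%:R - (class_size i)%:R).
Proof.
split=> [[EA EB] [|i] lis | E].
- by rewrite -lhsA_moment // EA rhsA_ratio.
- by rewrite -lhsB_moment // EB ?rhsB_ratio.
split=> [|[|i] // /andP[_ lis]].
- by rewrite lhsA_moment // rhsA_ratio E.
- by rewrite lhsB_moment // rhsB_ratio E.
Qed.

(** * Parity and divisibility *)

Definition bin2_sum i : nat := (\sum_(A in C i) 'C(#|B :&: A|, 2))%N.

(** Each square is n^2 = n + 2 binom(n,2), and the intersections with the classes add up to the size
    of [B]. *)
Lemma moment_bin2 i : (i <= s)%N ->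
  moment i B = #|B|%:R + (2 * bin2_sum i)%N%:R.
Proof.
move=> lis; have := sum_over_classes B (fun=> 1) lis.
rewrite sumr_const => <-; rewrite moment_sq // natrM natr_sum mulr_sumr.
rewrite -big_split /=.
apply: eq_bigr => A _; rewrite mulr1 -natrM mulnC.
rewrite -[2%N]/(2`!) bin_ffact ffactnS ffactn1 -natrX -natrD; congr (_%:R).
by rewrite -mulnn; case: #|_| => // n; rewrite mulnS.
Qed.

Lemma moment_diff i : (i < s)%N -> moment i.+1 B - moment i B
  = (2 * ((bin2_sum i.+1)%:Z - (bin2_sum i)%:Z))%:~R.
Proof.
move=> lis; rewrite (moment_bin2 lis) (moment_bin2 (ltnW lis)).
rewrite !natrM rmorphM rmorphB /=.
by rewrite !pmulrn; ring.
Qed.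

Lemma class_size_dvd i : (i <= s)%N -> (class_size i %| class_size s)%N.
Proof.
by move=> lis; rewrite /class_size (@big_cat_nat _ _ _ i.+1 1 s.+1) //= dvdn_mulr.
Qed.

Lemma dvd_ratio i : (i < s)%N ->
    moment i.+1 B - moment i B
      = pair_ratio * ((class_size i.+1)%:R - (class_size i)%:R) ->
  (class_size s - 1 %| 'C(#|B|, 2) * (e i.+1 - 1))%N.
Proof.
move=> lis; rewrite moment_diff // class_sizeS /pair_ratio.
set t := _ - _ => E; have top := class_size_top.
have ei : (0 < e i.+1)%N by apply/ltnW/he.
have cop : coprime (class_size s - 1) (class_size i).
  rewrite subn1; apply: coprime_dvdr (class_size_dvd (ltnW lis)) _.
  by rewrite coprimePn // ltnW.
rewrite -(Gauss_dvdl _ cop).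
(* The quotient [t] is a difference, so the divisibility is proved over the integers. *)
suff : ((class_size s - 1)%:Z %| ('C(#|B|, 2) * (e i.+1 - 1) * class_size i)%:Z)%Z by [].
apply/dvdzP; exists t; apply: (@intr_inj rat).
rewrite [RHS]intrM -!pmulrn !natrM !natrB ?(ltnW top) //.
have two : 2%:R != 0 :> rat by [].
have v0 := lt0r_neq0 top_gt1.
have C2 : 2 * ('C(#|B|, 2))%:R = #|B|%:R * (#|B|%:R - 1) :> rat.
  rewrite -natrM mulnC -[2%N]/(2`!) bin_ffact ffactnS ffactn1.
  by case: #|B| => [|n]; rewrite ?mul0r //= natrM -natr1 addrK.
move: E; rewrite intrM => E.
apply: (mulfI two); rewrite !mulrA C2 E natrM.
by field.
Qed.

(** * Transitivity on blocks and points, and the final assembly *)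

Lemma block_transitive_orbit : block_transitive G D.
Proof. by split; [apply: acts_orbit; apply: subsetT | apply: atrans_orbit]. Qed.

Lemma chain_imprimitive_orbit : (2 <= s)%N -> chain_imprimitive_design G s D.
Proof.
move=> s2; split; first by case: block_transitive_orbit.
split=> //.
  have /card_gt0P[x _] : (0 < #|T|)%N by rewrite hT ltnW // class_size_top.
  apply/imsetP; exists x; rewrite ?inE //; apply/setP=> y; rewrite inE.
  apply/esym/orbitP.
  (* Transitivity on points is the degenerate case of pairs with equal entries. *)
  have [|g gG [gx _]] := @stab_trans2 x x y y; last by exists g.
  by move=> i lis; rewrite !eqv_refl.
by exists C => // i lis; apply: (bigcap_inf (Ordinal (lis : i < s.+1)%N)).
Qed.

End Chain.

Theorem theorem1p3 (s : nat) (e : nat -> nat) (v : nat) (T : finType)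
    (C : nat -> {set {set T}}) (k : nat) (B : {set T})
    (hs : (2 <= s)%N)
    (he : forall i, (1 <= i <= s)%N -> (2 <= e i)%N)
    (hv : v = (\prod_(1 <= i < s.+1) e i)%N)
    (hT : #|T| = v)
    (hC : partition_chain s C)
    (hCe : forall i, (1 <= i <= s)%N -> forall A, A \in C i ->
             #|[set E in C i.-1 | E \subset A]| = e i)
    (hB : #|B| = k) :
  let G := chain_stabiliser s C in
  let D := orbit ('P^* )%act G B in
  let eqs := lhsA C B = rhsA e v k /\
             (forall i, (2 <= i <= s)%N -> lhsB C B i = rhsB e v k i) in
  ([/\ two_design D, block_transitive G D & chain_imprimitive_design G s D]
     <-> eqs) /\
  (eqs ->
     [/\ even_integer (lhsA C B) /\ even_integer (rhsA e v k),
         forall i, (2 <= i <= s)%N ->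
           even_integer (lhsB C B i) /\ even_integer (rhsB e v k i) &
         (v - 1 %| 'C(k, 2) * \big[gcdn/0]_(1 <= i < s.+1) (e i - 1))%N]).
Proof.
move=> G D eqs; have s0 : (0 < s)%N by apply: ltnW.
subst v k; rewrite -/(class_size e s) in hT eqs *.
have eqsP : eqs <-> _ := equations_moment e hC B s0.
split.
  rewrite eqsP -(two_design_moment hC hCe B he hT s0).
  split=> [[] // | D2]; split=> //.
    exact: block_transitive_orbit.
  exact: (chain_imprimitive_orbit hC hCe B he hT s0).
move=> E; have [EA EB] := E; have M := proj1 eqsP E.
split.
(* The right-hand side is even because it equals the left-hand side. *)
- rewrite -EA (lhsA_moment hC) // (moment_diff hC) //.
  by split; eexists.
- move=> [|i] // /[dup] /EB <- /andP[_ lis].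
  rewrite (lhsB_moment hC) // (moment_diff hC) //.
  by split; eexists.
(* The divisibility holds for 0, the neutral element of the gcd, and for each [e i - 1], and it
   passes to gcds. *)
- rewrite big_nat.
  elim/big_ind: _ => [|m n dm dn|[|i] // /andP[_ lis]]; first by rewrite muln0.
    by rewrite muln_gcdr dvdn_gcd dm.
  by apply: (dvd_ratio hC he) => //; apply: M.
Qed.
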